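(* Let $n\ge 4$ and $\ell\in\{3,\dots,n-1\}$. For the Grassmannian ${\rm Gr}(3,n)$, there is a sequence of combinatorial mutations taking the polytope $P_{\mathcal{B}_{\ell-1}}$ to $P_{\mathcal{B}_\ell}$.
   Context: For $k=3$: for each $3$-subset $I=\{i_1<i_2<i_3\}$ of $[n]$ a matching field assigns $\sigma=\Lambda(I)\in S_3$; its polytope $P_\Lambda\subset\mathbb{R}^{3\times n}$ is the convex hull of the vectors $\sum_{r=1}^3 e_{\sigma(r),i_r}$ ($e_{i,j}$ the standard basis matrices). For $0\le\ell\le n$, the block diagonal matching field $\mathcal{B}_\ell$ has $\mathcal{B}_\ell(I)=\mathrm{id}$ if $|I\cap\{1,\dots,\ell\}|\ne1$ and $(12)$ otherwise. Combinatorial mutation: with $N\cong\mathbb{Z}^d$, $M$ its dual, $w\in M$ primitive and $F\subset w^\perp\subset N_\mathbb{R}$ a lattice polytope, the tropical map is $\varphi_{w,F}(u)=u-(\min_{f\in F}\langle f,u\rangle)w$; if $P\subset M_\mathbb{R}$ is a lattice polytope containing the origin and $\varphi_{w,F}(P)$ is convex, it is a combinatorial mutation of $P$. A sequence of combinatorial mutations is a finite chain of polytopes in which consecutive polytopes are related, after identification via lattice-preserving affine isomorphisms (unimodular equivalences) of the lattices they span, either by a unimodular equivalence or by a combinatorial mutation. *)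

(* Defs.v *)
From HB Require Import structures.
From mathcomp Require Import all_boot all_order all_fingroup all_algebra.
From mathcomp Require Import reals.
Set Implicit Arguments.
Unset Strict Implicit.
Unset Printing Implicit Defensive.
Import Order.TTheory GRing.Theory Num.Theory.
Local Open Scope ring_scope.

Section Geometry.
Variable R : realType.

Definition pset (d : nat) := 'rV[R]_d -> Prop.
Definition seteq d (P Q : pset d) := forall x, P x <-> Q x.

(* standard pairing <f,u> between N_R and M_R (both identified with R^d) *)
Definition dotv d (f u : 'rV[R]_d) : R := \sum_(i < d) f 0 i * u 0 i.

Definition int_vec d (v : 'rV[R]_d) : Prop := forall i, exists z : int, v 0 i = z%:~R.

Definition primitive d (w : 'rV[R]_d) : Prop :=
  int_vec w /\
  forall (k : int) (v : 'rV[R]_d), int_vec v -> w = k%:~R *: v -> `|k| = 1.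

Definition conv d (V : seq 'rV[R]_d) : pset d := fun x =>
  exists c : 'I_(size V) -> R,
    (forall i, 0 <= c i) /\ \sum_i c i = 1 /\ x = \sum_i c i *: V`_i.

Definition convex d (P : pset d) : Prop :=
  forall x y t, P x -> P y -> 0 <= t <= 1 -> P (t *: x + (1 - t) *: y).

Definition lattice_polytope d (P : pset d) : Prop :=
  exists V : seq 'rV[R]_d, V != [::] /\ (forall v, v \in V -> int_vec v) /\
    seteq P (conv V).

Definition aff_hull d (P : pset d) : pset d := fun y =>
  exists k (p : 'I_k -> 'rV[R]_d) (c : 'I_k -> R),
    (forall i, P (p i)) /\ \sum_i c i = 1 /\ y = \sum_i c i *: p i.

(* Combinatorial mutation: Q = phi_{w,F}(P), where
   phi_{w,F}(u) = u - (min_{f in F} <f,u>) w, F = conv Fv subset w^perp a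
   lattice polytope, w primitive, P a lattice polytope containing 0, and
   phi_{w,F}(P) convex. *)
Definition comb_mutation d (P Q : pset d) : Prop :=
  lattice_polytope P /\ P 0 /\
  exists (w : 'rV[R]_d) (Fv : seq 'rV[R]_d),
    [/\ primitive w, Fv != [::],
        (forall f, f \in Fv -> int_vec f /\ dotv f w = 0),
        seteq Q (fun y => exists u, P u /\
           exists m : R,
             [/\ (exists f, conv Fv f /\ dotv f u = m),
                 (forall f, conv Fv f -> m <= dotv f u) &
                 y = u - m *: w])
      & convex Q].

Definition unimod_equiv d (Q1 Q2 : pset d) : Prop :=
  exists (t : 'rV[R]_d) (U : 'M[R]_d),
    [/\ int_vec t, (forall i j, exists z : int, U i j = z%:~R),
        (\det U = 1 \/ \det U = -1) &
        seteq Q2 (fun y => exists x, Q1 x /\ y = t + x *m U)].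

Definition identifies D d (P : pset D) (Q : pset d) : Prop :=
  exists (b : 'rV[R]_D) (M : 'M[R]_(d, D)),
    [/\ int_vec b, (forall i j, exists z : int, M i j = z%:~R), row_free M,
        (forall y, (int_vec y /\ aff_hull P y) <->
                   exists z, int_vec z /\ y = b + z *m M) &
        seteq P (fun y => exists x, Q x /\ y = b + x *m M)].

Definition poly := {D : nat & pset D}.

Definition mut_step (p q : poly) : Prop :=
  exists d (Q1 Q2 : pset d),
    [/\ identifies (projT2 p) Q1, identifies (projT2 q) Q2 &
        (unimod_equiv Q1 Q2 \/ comb_mutation Q1 Q2)].

Inductive mut_seq : poly -> poly -> Prop :=
| mut_seq_refl p : mut_seq p p
| mut_seq_cons p q r : mut_step p q -> mut_seq q r -> mut_seq p r.

Definition rk n (I : {set 'I_n}) (j : 'I_n) : nat := #|[set k in I | (k < j)%N]|.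

(* the vertex sum_r e_{sigma(r), i_r} as a 3 x n matrix *)
Definition mf_vertex n (sigma : 'S_3) (I : {set 'I_n}) : 'M[R]_(3, n) :=
  \matrix_(a < 3, j < n) ((j \in I) && (sigma (inord (rk I j)) == a))%:R.

Definition three_subsets n : seq {set 'I_n} :=
  enum [set I : {set 'I_n} | #|I| == 3].

Definition mf_polytope n (Lam : {set 'I_n} -> 'S_3) : pset (3 * n) :=
  conv [seq mxvec (mf_vertex (Lam J) J) | J <- three_subsets n].

End Geometry.

(* block diagonal matching field B_l: id if |I cap {1..l}| <> 1, (12) otherwise.
   (0-based: {1..l} is {j : 'I_n | j < l}, rows 1,2 are ord0 and 1.) *)
Definition block_diag n (l : nat) (I : {set 'I_n}) : 'S_3 :=
  if #|[set j in I | (j < l)%N]| == 1%N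
  then tperm (ord0 : 'I_3) (inord 1)
  else 1%g.

(* Main.v *)
Require Import Defs.
From mathcomp Require Import all_boot all_order all_fingroup all_algebra.
From mathcomp Require Import boolp reals.
From mathcomp Require Import zify lra ring.
Set Implicit Arguments.
Unset Strict Implicit.
Unset Printing Implicit Defensive.
Import Order.TTheory GRing.Theory Num.Theory.
Local Open Scope ring_scope.

(** For a linear order tau on the columns, consider the matching field sending
    i < j < k to the vertex in which k goes to row 3 and, of i and j, the one
    that is larger for tau goes to row 2 and the other to row 1.  The field B_l
    is given by the order l > ... > 1 > n > ... > l+1, so one passes from
    B_(l-1) to B_l by moving the column m = l from the bottom of the order to
    its top, one adjacent swap of m with a column j at a time.

    Such a swap adds w = e_(2,m) - e_(1,m) + e_(1,j) - e_(2,j) to the vertices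
    of the triples {m,j,k} and fixes the others.  Let f be the functional with
    value [y > j] - [x >= m] (for tau) on the vertex with x in row 1 and y in
    row 2: it kills w, takes the values -1, 0, 1 on vertices, and is -1 exactly
    on the vertices that move.  The image of the polytope under the tropical map
    of w and conv {0, f} is convex because any two vertices a, b at heights -1
    and 1 satisfy a + b = c + d and a + b + w = c' + d' for vertices c, d, c', d'
    at height 0.  If both heights occur, then w is parallel to the affine hull
    and the swap is a combinatorial mutation; otherwise the tropical map agrees
    on the polytope with a unimodular map of the ambient lattice. *)

(** * Lattice bases *)

Section IntegralMatrices.
Variable R : realType.

Definition intmx m n (A : 'M[R]_(m, n)) := A \is a mxOver Num.int.

Lemma intmxP m n (A : 'M[R]_(m, n)) :
  reflect (forall i j, exists z : int, A i j = z%:~R) (intmx A).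
Proof. by apply: (iffP mxOverP) => H i j; apply/intrP/H. Qed.

Lemma int_vecP d (v : 'rV[R]_d) : reflect (int_vec v) (intmx v).
Proof.
by apply: (iffP (intmxP _)) => H i; [exact: H | move=> j; rewrite (ord1 i); apply: H].
Qed.

Lemma intmxM m n p (A : 'M[R]_(m, n)) (B : 'M[R]_(n, p)) :
  intmx A -> intmx B -> intmx (A *m B).
Proof. exact: mxOverM. Qed.

Lemma intmxB m n (A B : 'M[R]_(m, n)) : intmx A -> intmx B -> intmx (A - B).
Proof.
move=> /mxOverP iA /mxOverP iB; apply/mxOverP => i j.
by rewrite !mxE rpredB.
Qed.

Lemma intmxD m n (A B : 'M[R]_(m, n)) : intmx A -> intmx B -> intmx (A + B).
Proof.
move=> /mxOverP iA /mxOverP iB; apply/mxOverP => i j.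
by rewrite !mxE rpredD.
Qed.

(* The rows of the right Smith factor with nonzero invariant factor form a
   basis of the saturated lattice. *)
Lemma lattice_basis m D (X : 'M[R]_(m, D)) : intmx X ->
  exists d (M : 'M[R]_(d, D)),
    [/\ intmx M, row_free M, (X :=: M)%MS &
        forall y : 'rV_D, intmx y -> (y <= M)%MS -> intmx (y *m pinvmx M)].
Proof.
move=> /mxOverP intX.
pose Y : 'M[int]_(m, D) := \matrix_(i, j) Num.floor (X i j).
have XY : X = map_mx intr Y.
  apply/matrixP => i j; rewrite !mxE; have := intX i j.
  by rewrite intrEfloor => /eqP.
have [L uL [N uN [ds _ defY]]] := int_Smith_normal_form Y.
pose toR p q (A : 'M[int]_(p, q)) : 'M[R]_(p, q) := map_mx intr A.
pose E : 'M[int]_(m, D) := \matrix_(i, j) (ds`_i *+ (i == j :> nat)).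
have toRM p q r (A : 'M[int]_(p, q)) (B : 'M[int]_(q, r)) :
  toR _ _ (A *m B) = toR _ _ A *m toR _ _ B by exact: map_mxM.
have toR1 p : toR p p 1%:M = 1%:M by rewrite /toR map_mx1.
have NV : toR _ _ N *m toR _ _ (invmx N) = 1%:M by rewrite -toRM mulmxV.
have VL : toR _ _ (invmx L) *m toR _ _ L = 1%:M by rewrite -toRM mulVmx.
(* The default value 0 of [nth] makes indices past the end of [ds] count as zero invariant factors;
   [j < m] keeps the columns that meet the diagonal of [E]. *)
pose S := [pred j : 'I_D | (j < m)%N && (ds`_j != 0)].
pose g (s : 'I_#|S|) : 'I_D := enum_val s.
pose M := rowsub g (toR _ _ N); pose B := colsub g (toR _ _ (invmx N)).
have MB : M *m B = 1%:M.
  rewrite -mxsub_mul NV; apply/matrixP => i j; rewrite !mxE.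
  by rewrite (inj_eq enum_val_inj).
have EN : toR _ _ E *m toR _ _ N = colsub g (toR _ _ E) *m M.
  apply/matrixP => i k; rewrite !mxE (bigID S) /= [X in _ + X]big1 ?addr0.
    rewrite big_enum_val /=; apply: eq_bigr => s _; rewrite !mxE //.
  move=> j; rewrite negb_and negbK => jS; rewrite !mxE.
  case: (eqVneq (i : nat) j) => [ij|]; last by rewrite mul0r.
  by move: jS; rewrite -ij ltn_ord /= => /eqP->; rewrite mul0r.
exists #|S|, M; split.
- by apply/mxOverP => i j; rewrite !mxE; apply/intrP; exists (N (g i) j).
- by apply/row_freeP; exists B.
- apply/eqmxP/andP; split.
    by rewrite XY defY -/(toR _ _ _) !toRM -mulmxA EN mulmxA submxMl.
  apply/row_subP => s; have /andP[lt_m nz] := enum_valP s.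
  pose i := Ordinal lt_m.
  (* Undoing [L] leaves the diagonal times [N], so a row of [N] with nonzero invariant factor is a
     rational multiple of a combination of rows of [X]. *)
  have -> : row s M = (ds`_(g s))%:~R^-1 *: row i (toR _ _ (invmx L) *m X).
    rewrite XY defY -/(toR _ _ _) !toRM -mulmxA mulmxA VL mul1mx.
    apply/rowP => k; rewrite !mxE (bigD1 (g s)) //= !mxE eqxx mulr1n.
    rewrite big1 ?addr0 ?mulKf ?intr_eq0 // => j.
    by rewrite -val_eqE !mxE /= eq_sym => /negbTE->; rewrite mul0r.
  by rewrite scalemx_sub // (submx_trans (row_sub _ _)) // submxMl.
(* Coordinates on the row space of [M] are unique, so the integral right inverse [B] computes the
   same ones as [pinvmx M]. *)
move=> y iy yM; have -> : y *m pinvmx M = y *m B.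
  by rewrite -{2}(mulmxKpV yM) -(mulmxA _ M B) MB mulmx1.
apply: intmxM => //; apply/mxOverP => i j; rewrite !mxE.
by apply/intrP; exists (invmx N i (g j)).
Qed.

End IntegralMatrices.

(** * Polyhedral cones and the tropical map *)

Section Cones.
Variables (R : realType) (D : nat).
Implicit Types (f u v w x y n p z : 'rV[R]_D) (V : 'rV[R]_D -> Prop).

Lemma dotv_mx f u : dotv f u = (u *m f^T) 0 0.
Proof. by rewrite !mxE; apply: eq_bigr => i _; rewrite !mxE mulrC. Qed.

Lemma dotvD f x y : dotv f (x + y) = dotv f x + dotv f y.
Proof. by rewrite !dotv_mx mulmxDl mxE. Qed.

Lemma dotvZ f a x : dotv f (a *: x) = a * dotv f x.
Proof. by rewrite !dotv_mx -scalemxAl mxE. Qed.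

Lemma dotv0 f : dotv f 0 = 0.
Proof. by rewrite dotv_mx mul0mx mxE. Qed.

Lemma dotvN f x : dotv f (- x) = - dotv f x.
Proof. by rewrite -scaleN1r dotvZ mulN1r. Qed.

Definition dotvE := (dotvD, dotvN, dotvZ, dotv0).

Inductive cone V : 'rV[R]_D -> Prop :=
| cone_0 : cone V 0
| cone_cons a v x : 0 <= a -> V v -> cone V x -> cone V (a *: v + x).

Lemma coneD V x y : cone V x -> cone V y -> cone V (x + y).
Proof.
elim=> [|a v z a0 Vv _ IH] Cy; first by rewrite add0r.
by rewrite -addrA; apply: cone_cons => //; apply: IH.
Qed.

Lemma coneZ V a x : 0 <= a -> cone V x -> cone V (a *: x).
Proof.
move=> a0; elim=> [|b v z b0 Vv _ IH]; first by rewrite scaler0; constructor.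
by rewrite scalerDr scalerA; apply: cone_cons => //; apply: mulr_ge0.
Qed.

Lemma cone_gen V v : V v -> cone V v.
Proof.
by move=> Vv; rewrite -[v]addr0 -[v]scale1r; apply: cone_cons => //; constructor.
Qed.

Lemma cone_mono V V' x : (forall v, V v -> V' v) -> cone V x -> cone V' x.
Proof.
by move=> sub; elim=> [|a v y a0 /sub Vv _]; [constructor | apply: cone_cons].
Qed.

Lemma cone_linear V V' (g : 'rV[R]_D -> 'rV[R]_D) x : linear g ->
  (forall v, V v -> cone V' (g v)) -> cone V x -> cone V' (g x).
Proof.
move=> lin sub; elim=> [|a v y a0 Vv _ IH].
  have := lin (-1) 0 0; rewrite scaler0 addr0 scaleN1r addNr => ->.
  by constructor.
by rewrite lin; apply: coneD => //; apply: coneZ => //; apply: sub.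
Qed.

Section Wall.
Variable f : 'rV[R]_D.

Definition neg V v := V v /\ dotv f v = -1.
Definition zer V v := V v /\ dotv f v = 0.
Definition pos V v := V v /\ dotv f v = 1.

Definition small_heights V :=
  forall v, V v -> [\/ dotv f v = -1, dotv f v = 0 | dotv f v = 1].

Definition exchange V := forall a b, neg V a -> pos V b ->
  exists c d, [/\ zer V c, zer V d & a + b = c + d].

Lemma cone_split V x : small_heights V -> cone V x ->
  exists n z p, [/\ cone (neg V) n, cone (zer V) z, cone (pos V) p & x = n + z + p].
Proof.
move=> hV; elim=> [|a v y a0 Vv _ [n [z [p [Cn Cz Cp ->]]]]].
  by exists 0, 0, 0; rewrite !addr0; split=> //; constructor.
case: (hV _ Vv) => fv.
- exists (a *: v + n), z, p; rewrite !addrA; split=> //.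
  by apply: cone_cons.
- exists n, (a *: v + z), p; rewrite !addrA (addrC n); split=> //.
  by apply: cone_cons.
- exists n, z, (a *: v + p); rewrite [RHS]addrCA !addrA; split=> //.
  by apply: cone_cons.
Qed.

Lemma cone_neg V n : cone (neg V) n -> n = 0 \/ dotv f n < 0.
Proof.
elim=> [|a v y a0 [_ fv] _ IH]; first by left.
move: a0; rewrite le0r => /orP[/eqP-> | a0]; first by rewrite scale0r add0r.
by right; rewrite !dotvE fv; case: IH => [->|]; rewrite ?dotv0; lra.
Qed.

Lemma cone_pos V p : cone (pos V) p -> p = 0 \/ 0 < dotv f p.
Proof.
elim=> [|a v y a0 [_ fv] _ IH]; first by left.
move: a0; rewrite le0r => /orP[/eqP-> | a0]; first by rewrite scale0r add0r.
by right; rewrite !dotvE fv; case: IH => [->|]; rewrite ?dotv0; lra.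
Qed.

(** The expression is bilinear in [n] and [p], and for generators at heights -1 and 1 it is their
    sum, which [exchange] places on the wall. *)
Lemma cone_balance V n p : exchange V -> cone (neg V) n -> cone (pos V) p ->
  cone (zer V) (dotv f p *: n - dotv f n *: p).
Proof.
move=> ex Cn Cp; elim: Cn => [|a v y a0 nv _ IH].
  by rewrite dotv0 scale0r scaler0 subr0; constructor.
have -> : dotv f p *: (a *: v + y) - dotv f (a *: v + y) *: p =
    a *: (dotv f p *: v + p) + (dotv f p *: y - dotv f y *: p).
  rewrite !dotvE (proj2 nv); apply/rowP => i; rewrite !mxE; ring.
apply: coneD => //; apply: coneZ => //.
elim: Cp {IH} => [|b u q b0 pu _ IH].
  by rewrite dotv0 scale0r add0r; constructor.
have -> : dotv f (b *: u + q) *: v + (b *: u + q) =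
    b *: (v + u) + (dotv f q *: v + q).
  rewrite !dotvE (proj2 pu); apply/rowP => i; rewrite !mxE; ring.
apply: coneD => //; apply: coneZ => //.
by have [c [d [zc zd ->]]] := ex _ _ nv pu; apply: coneD; apply: cone_gen.
Qed.

(* The lighter of the two sides is absorbed by the heavier one: each unit of
   mass at height -1 is exchanged against mass at height 1 for mass on the wall. *)
Lemma cone_sides V x : small_heights V -> exchange V -> cone V x ->
  cone (fun v => V v /\ 0 <= dotv f v) x \/ cone (fun v => V v /\ dotv f v <= 0) x.
Proof.
move=> hV ex /(cone_split hV)[n [z [p [Cn Cz Cp ->]]]].
have zge y : cone (zer V) y -> cone (fun v => V v /\ 0 <= dotv f v) y.
  by apply: cone_mono => v [? ->].
have zle y : cone (zer V) y -> cone (fun v => V v /\ dotv f v <= 0) y.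
  by apply: cone_mono => v [? ->].
have pge y : cone (pos V) y -> cone (fun v => V v /\ 0 <= dotv f v) y.
  by apply: cone_mono => v [? ->].
have nle y : cone (neg V) y -> cone (fun v => V v /\ dotv f v <= 0) y.
  by apply: cone_mono => v [? ->]; split=> //; lra.
have bal := cone_balance ex Cn Cp.
have [n0|fn] := cone_neg Cn.
  by left; rewrite n0 add0r; apply: coneD; auto.
have [p0|fp] := cone_pos Cp.
  by right; rewrite p0 addr0; apply: coneD; auto.
have fp0 : dotv f p != 0 by rewrite gt_eqF.
have fn0 : dotv f n != 0 by rewrite lt_eqF.
have [le|le] := leP (- dotv f n) (dotv f p).
  left; have -> : n + z + p = (dotv f p)^-1 *: (dotv f p *: n - dotv f n *: p)
      + z + (1 + dotv f n / dotv f p) *: p.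
    by apply/rowP => i; rewrite !mxE; field.
  apply: coneD; first apply: coneD; auto.
    by apply/zge/coneZ => //; rewrite invr_ge0 ltW.
  apply/pge/coneZ => //; rewrite -(pmulr_rge0 _ fp) mulrDr mulr1 mulrCA divff //.
  by rewrite mulr1; lra.
right; have -> : n + z + p = (- dotv f n)^-1 *: (dotv f p *: n - dotv f n *: p)
    + z + (1 + dotv f p / dotv f n) *: n.
  by apply/rowP => i; rewrite !mxE; field.
apply: coneD; first apply: coneD; auto.
  by apply/zle/coneZ => //; rewrite invr_ge0 oppr_ge0 ltW.
apply/nle/coneZ => //; rewrite -(nmulr_rle0 _ fn) mulrDr mulr1 mulrCA divff //.
by rewrite mulr1; lra.
Qed.

Variable w : 'rV[R]_D.
Hypothesis fw : dotv f w = 0.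

(** On the segment from 0 to [f] a linear form is minimal at an endpoint, so this is the tropical
    map of [w] and that segment. *)
Definition trop x := x - Num.min 0 (dotv f x) *: w.

Lemma trop_ge0 x : 0 <= dotv f x -> trop x = x.
Proof. by move=> h; rewrite /trop min_l // scale0r subr0. Qed.

Lemma trop_le0 x : dotv f x <= 0 -> trop x = x - dotv f x *: w.
Proof. by move=> h; rewrite /trop min_r. Qed.

Lemma dotv_trop x : dotv f (trop x) = dotv f x.
Proof. by rewrite /trop !dotvE fw mulr0 subr0. Qed.

(** [a = 1] gives the branch of [trop] on nonpositive heights, [a = -1] its inverse. *)
Fact shear_linear a : linear (fun x : 'rV[R]_D => x - (a * dotv f x) *: w).
Proof. by move=> c x y; apply/rowP => i; rewrite !dotvE !mxE; ring. Qed.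

(** [trop] is linear on each closed side of the wall, and by [cone_sides] every point of either cone
    is a combination of generators from a single side. Exchange in [V'] gives the direction from
    left to right, hence the convexity of the image. *)
Lemma cone_trop V V' y : small_heights V -> exchange V -> exchange V' ->
  (forall v, V' v <-> exists u, V u /\ v = trop u) ->
  cone V' y <-> exists x, cone V x /\ y = trop x.
Proof.
move=> hV ex ex' V'E; have hV' : small_heights V'.
  by move=> v /V'E[u [/hV Vu ->]]; rewrite dotv_trop.
have sgn W x : (forall v, W v -> 0 <= dotv f v) -> cone W x -> 0 <= dotv f x.
  move=> h; elim=> [|a v z a0 /h Wv _ IH]; rewrite !dotvE //.
  by rewrite addr_ge0 // mulr_ge0.
have sgn' W x : (forall v, W v -> dotv f v <= 0) -> cone W x -> dotv f x <= 0.
  move=> h; elim=> [|a v z a0 /h Wv _ IH]; rewrite !dotvE //.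
  by have := mulr_ge0_le0 a0 Wv; lra.
split=> [|[x [Cx ->]]].
  case/(cone_sides hV' ex') => Cy.
    exists y; rewrite trop_ge0; last by apply: sgn Cy => v [].
    split=> //; apply: cone_mono Cy => v [/V'E[u [Vu ->]]].
    by rewrite dotv_trop => /trop_ge0->.
  have fy : dotv f y <= 0 by apply: sgn' Cy => v [].
  (* Since [trop] preserves heights, the opposite shear undoes it on this side. *)
  exists (y + dotv f y *: w); split; last first.
    rewrite trop_le0 ?dotvE ?fw ?mulr0 ?addr0 //.
    by rewrite addrK.
  have := @cone_linear _ V (fun x : 'rV[R]_D => x - (-1 * dotv f x) *: w) y
    (shear_linear (-1)) _ Cy.
  rewrite /= mulN1r scaleNr opprK; apply=> v [/V'E[u [Vu ->]]].
  rewrite dotv_trop => fu; rewrite mulN1r scaleNr opprK.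
  by rewrite trop_le0 // subrK; apply: cone_gen.
have [Cx'|Cx'] := cone_sides hV ex Cx.
  rewrite trop_ge0; last by apply: sgn Cx' => v [].
  apply: cone_mono Cx' => v [Vv fv]; apply/V'E; exists v.
  by rewrite trop_ge0.
rewrite trop_le0; last by apply: sgn' Cx' => v [].
have := @cone_linear _ V' (fun x : 'rV[R]_D => x - (1 * dotv f x) *: w) x
  (shear_linear 1) _ Cx'.
rewrite /= mul1r; apply=> v [Vv fv]; rewrite mul1r -trop_le0 //.
by apply/cone_gen/V'E; exists v.
Qed.

End Wall.

(** On generators with [dotv h v = 1], the value of [h] on a conic combination is the sum of its
    coefficients. The convex hull is thus a slice of the cone, and results on cones descend to
    polytopes. *)
Lemma conv_coneP (S : seq 'rV[R]_D) (h : 'rV[R]_D) x :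
  (forall v, v \in S -> dotv h v = 1) ->
  conv S x <-> cone (fun v => v \in S) x /\ dotv h x = 1.
Proof.
move=> hS; split=> [[c [c0 [c1 ->]]]|[Cx hx]].
  split; first elim/big_ind: _ => [|y z|i _].
  - by constructor.
  - exact: coneD.
  - by apply: coneZ => //; apply/cone_gen/mem_nth.
  rewrite (big_morph (dotv h) (dotvD h) (dotv0 h)) -c1.
  by apply: eq_bigr => i _; rewrite dotvZ hS ?mulr1 ?mem_nth.
have [c [c0 xE]] : exists c : 'I_(size S) -> R,
    (forall i, 0 <= c i) /\ x = \sum_i c i *: S`_i.
  elim: Cx {hx} => [|a v y a0 Sv _ [c [c0 ->]]].
    by exists (fun=> 0); split=> //; rewrite big1 // => i _; rewrite scale0r.
  have lt_v : (index v S < size S)%N by rewrite index_mem.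
  exists (fun i => a *+ (i == Ordinal lt_v) + c i); split=> [i|].
    by rewrite addr_ge0 // mulrn_wge0.
  under [RHS]eq_bigr do rewrite scalerDl.
  rewrite big_split /= [X in _ = X + _](bigD1 (Ordinal lt_v)) //= eqxx.
  rewrite mulr1n nth_index //; congr (_ + _); rewrite big1 ?addr0 // => i /negbTE->.
  by rewrite mulr0n scale0r.
exists c; split=> //; split=> //.
rewrite -hx xE (big_morph (dotv h) (dotvD h) (dotv0 h)).
by apply: eq_bigr => i _; rewrite dotvZ hS ?mulr1 ?mem_nth.
Qed.

End Cones.

(** * Identification of lattices *)

Section Identification.
Variables (R : realType) (D : nat).
Implicit Types (b y : 'rV[R]_D) (V : seq 'rV[R]_D).

Lemma conv_mem d (V : seq 'rV[R]_d) v : v \in V -> conv V v.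
Proof.
move=> Vv; have lt_v : (index v V < size V)%N by rewrite index_mem.
exists (fun i => (i == Ordinal lt_v)%:R); split; first by move=> i; apply: ler0n.
split.
  rewrite (bigD1 (Ordinal lt_v)) //= eqxx big1 ?addr0 // => i /negbTE->; exact: erefl.
rewrite (bigD1 (Ordinal lt_v)) //= eqxx scale1r nth_index // big1 ?addr0 //.
by move=> i /negbTE->; rewrite scale0r.
Qed.

Lemma conv_convex d (V : seq 'rV[R]_d) : convex (conv V).
Proof.
move=> x y t [c [c0 [c1 ->]]] [e [e0 [e1 ->]]] /andP[t0 t1].
exists (fun i => t * c i + (1 - t) * e i); split=> [i|].
  by rewrite addr_ge0 // mulr_ge0 // subr_ge0.
split; first by rewrite big_split /= -!mulr_sumr c1 e1 !mulr1 addrC subrK.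
rewrite !scaler_sumr -big_split /=; apply: eq_bigr => i _.
by rewrite !scalerA -scalerDl.
Qed.

Lemma conv_segmentP d (f g : 'rV[R]_d) :
  conv [:: 0; f] g <-> exists2 t, 0 <= t <= 1 & g = t *: f.
Proof.
split=> [[c [c0 []]]|[t /andP[t0 t1] ->]].
  rewrite !big_ord_recl !big_ord0 /= scaler0 add0r !addr0 => c1 ->.
  exists (c (lift ord0 ord0)) => //; rewrite c0 /=.
  by have := c0 ord0; lra.
have -> : t *: f = t *: f + (1 - t) *: 0 by rewrite scaler0 addr0.
apply: conv_convex; rewrite ?t0 //; apply: conv_mem; rewrite !inE eqxx ?orbT //.
Qed.

Definition dirmx V b : 'M[R]_(size V, D) := \matrix_(i < size V) (V`_i - b).

Lemma row_dirmx V b i : row i (dirmx V b) = V`_i - b.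
Proof. by rewrite rowK. Qed.

Lemma sub_dirmx V b v : v \in V -> (v - b <= dirmx V b)%MS.
Proof.
move=> Vv; have lt_v : (index v V < size V)%N by rewrite index_mem.
by rewrite -{1}(nth_index 0 Vv) -(row_dirmx b (Ordinal lt_v)) row_sub.
Qed.

Lemma aff_hull_conv V b y : b \in V ->
  aff_hull (conv V) y <-> (y - b <= dirmx V b)%MS.
Proof.
move=> Vb; split=> [[k [p [c [Pp [c1 ->]]]]]|/submxP[u yE]].
  rewrite -[b in X in (X <= _)%MS]scale1r -c1 scaler_suml -sumrB.
  apply: summx_sub => i _; rewrite -scalerBr scalemx_sub //.
  have [e [_ [e1 ->]]] := Pp i.
  rewrite -[b in X in (X <= _)%MS]scale1r -e1 scaler_suml -sumrB.
  by apply: summx_sub => j _; rewrite -scalerBr scalemx_sub // sub_dirmx ?mem_nth.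
(* The extra index [ord0] carries [b], with the weight that brings the total to 1. *)
exists (size V).+1, (fun i => if unlift ord0 i is Some j then V`_j else b).
exists (fun i => if unlift ord0 i is Some j then u 0 j else 1 - \sum_j u 0 j).
split=> [i|]; first by case: unliftP => [j|] _; apply: conv_mem; rewrite ?mem_nth.
rewrite !big_ord_recl /= unlift_none.
under [X in _ + X = 1 /\ _]eq_bigr do rewrite liftK.
rewrite subrK; split=> //; under [X in _ + X]eq_bigr do rewrite liftK.
rewrite scalerBl scale1r scaler_suml.
rewrite addrAC -addrA -sumrB addrC -[LHS](subrK b); congr (_ + _).
rewrite yE mulmx_sum_row; apply: eq_bigr => j _.
by rewrite row_dirmx scalerBr.
Qed.

Lemma conv_affine d V b (M : 'M[R]_(d, D)) (W : seq 'rV[R]_d) (x : 'rV[R]_d) :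
  row_free M -> V = [seq b + z *m M | z <- W] ->
  conv V (b + x *m M) <-> conv W x.
Proof.
move=> fM ->; rewrite /conv size_map; set S := [seq _ | _ <- _].
have E c : \sum_(i < size W) c i = 1 ->
    \sum_(i < size W) c i *: S`_i = b + (\sum_(i < size W) c i *: W`_i) *m M.
  move=> c1; rewrite -[b]scale1r -c1 scaler_suml mulmx_suml -big_split /=.
  by apply: eq_bigr => i _; rewrite (nth_map 0) // -scalemxAl -scalerDr.
split=> [[c [c0 [c1 xE]]]|[c [c0 [c1 ->]]]]; exists c; do 2!split=> //.
  by move: xE; rewrite E // => /addrI/(row_free_inj fM).
by rewrite E.
Qed.

(** With the vertex [b] as origin, saturation of the row lattice of [M] ensures that every lattice
    point of the affine hull has integral coordinates. *)
Lemma identifies_conv d V b (M : 'M[R]_(d, D)) : b \in V -> intmx b ->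
    intmx M -> row_free M -> (dirmx V b :=: M)%MS ->
    (forall y : 'rV_D, intmx y -> (y <= M)%MS -> intmx (y *m pinvmx M)) ->
  identifies (conv V) (fun x => conv V (b + x *m M)).
Proof.
move=> Vb ib iM fM VM sat; exists b, M; split=> //.
- exact/int_vecP.
- exact/intmxP.
- move=> y; rewrite (aff_hull_conv _ Vb) VM; split=> [[/int_vecP iy yM]|].
    exists ((y - b) *m pinvmx M); rewrite mulmxKpV // (addrC b) subrK; split=> //.
    by apply/int_vecP/sat => //; apply: intmxB.
  move=> [z [/int_vecP iz ->]]; split; last by rewrite addrC addKr submxMl.
  by apply/int_vecP; apply: intmxD => //; apply: intmxM.
move=> y; split=> [Py|[x [? ->]] //].
have /(aff_hull_conv y Vb) yM : aff_hull (conv V) y.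
  by exists 1%N, (fun=> y), (fun=> 1); rewrite !big_ord1 scale1r.
exists ((y - b) *m pinvmx M).
by rewrite mulmxKpV -?VM // (addrC b) subrK.
Qed.

(** One [Q] is a chart for both polytopes, read through [M] and through [M *m U]; the step is then
    the identity equivalence. *)
Lemma mut_step_unimodular (P P' : pset R D) d (Q : pset R d) (U U' : 'M[R]_D) :
    identifies P Q -> intmx U -> intmx U' -> U *m U' = 1%:M ->
    (forall y, P' y <-> P (y *m U')) ->
  mut_step (existT (pset R) D P) (existT (pset R) D P').
Proof.
move=> [b [M [/int_vecP ib /intmxP iM fM latE PE]]] iU iU' UU' P'E.
have U'K (x : 'rV[R]_D) : x *m U' *m U = x.
  by rewrite -mulmxA (mulmx1C UU') mulmx1.
have P'U x : P x <-> P' (x *m U) by rewrite P'E -mulmxA UU' mulmx1.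
have uU : row_free U by apply/row_freeP; exists U'.
exists d, Q, Q; split; [by exists b, M; split=> //; [exact/int_vecP | exact/intmxP]| |].
  exists (b *m U), (M *m U); split.
  - by apply/int_vecP/intmxM.
  - by apply/intmxP/intmxM.
  - by rewrite /row_free mxrankMfree.
  - move=> y; have affE : aff_hull P' y <-> aff_hull P (y *m U').
      split=> [[k [p [c [Pp [c1 ->]]]]]|[k [p [c [Pp [c1 yE]]]]]].
        exists k, (fun i => p i *m U'), c; split=> [i|]; first exact/P'E.
        split=> //; rewrite mulmx_suml; apply: eq_bigr => i _.
        by rewrite scalemxAl.
      exists k, (fun i => p i *m U), c; split=> [i|]; first exact/P'U.
      split=> //; rewrite -[LHS]U'K yE mulmx_suml.
      by apply: eq_bigr => i _; rewrite scalemxAl.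
    rewrite affE /=; split=> [[/int_vecP iy ay]|[z [/int_vecP iz ->]]].
      have [|z [iz yE]] := (latE (y *m U')).1.
        by split=> //; apply/int_vecP/intmxM.
      by exists z; split=> //; rewrite -[LHS]U'K yE mulmxDl mulmxA.
    split; first by apply/int_vecP/intmxD; apply: intmxM => //; apply: intmxM.
    rewrite mulmxA -mulmxDl -mulmxA UU' mulmx1.
    by apply: ((latE _).2 _).2; exists z; split=> //; apply/int_vecP.
  move=> y; rewrite /= P'E PE; split=> [[x [Qx yE]]|[x [Qx ->]]]; exists x; split=> //.
    by rewrite -[LHS]U'K yE mulmxDl mulmxA.
  by rewrite mulmxA -mulmxDl -mulmxA UU' mulmx1.
left; exists 0, 1%:M; split.
- by apply/int_vecP; apply/mxOverP => i j; rewrite mxE.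
- by move=> i j; exists (i == j)%:R; rewrite mxE; case: eqP.
- by left; rewrite det1.
- move=> y; split=> [Qy|[x [Qx ->]]]; last by rewrite add0r mulmx1.
  by exists y; rewrite add0r mulmx1.
Qed.

End Identification.

(** * Mutations across a wall *)

Section Mutation.
Variables (R : realType) (D : nat).

Lemma conv_eq_mem (h : 'rV[R]_D) (V W : seq 'rV[R]_D) x :
    (forall v, v \in V -> dotv h v = 1) -> (forall v, v \in W <-> v \in V) ->
  conv W x <-> conv V x.
Proof.
move=> hV WV; rewrite !(@conv_coneP _ _ _ h) //; last by move=> v /WV/hV.
by split=> -[C hx]; split=> //; apply: cone_mono C => v /WV.
Qed.

Variables (V V' : seq 'rV[R]_D) (f w h : 'rV[R]_D).
Hypotheses (V0 : V != [::]) (iV : forall v, v \in V -> intmx v).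
Hypotheses (hV : forall v, v \in V -> dotv h v = 1) (hw : dotv h w = 0).
Hypotheses (i_f : intmx f) (pw : primitive w) (fw : dotv f w = 0).
Hypothesis small : small_heights f (fun v => v \in V).
Hypothesis V'E : forall v, v \in V' <-> exists u, u \in V /\ v = trop f w u.
Hypothesis ex : forall a b,
  neg f (fun v => v \in V) a -> pos f (fun v => v \in V) b ->
  exists c d c' d', [/\ zer f (fun v => v \in V) c, zer f (fun v => v \in V) d,
    zer f (fun v => v \in V) c' & zer f (fun v => v \in V) d'] /\
    a + b = c + d /\ a + b + w = c' + d'.

Let zerV' c : zer f (fun v => v \in V) c -> zer f (fun v => v \in V') c.
Proof. by case=> Vc fc; split=> //; apply/V'E; exists c; rewrite trop_ge0 ?fc. Qed.

Let hV' v : v \in V' -> dotv h v = 1.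
Proof. by case/V'E=> u [Vu ->]; rewrite /trop !dotvE hw mulr0 subr0 hV. Qed.

Lemma conv_trop y : conv V' y <-> exists x, conv V x /\ y = trop f w x.
Proof.
have htrop x : dotv h (trop f w x) = dotv h x.
  by rewrite /trop !dotvE hw mulr0 subr0.
rewrite (conv_coneP _ hV') (@cone_trop _ _ f w fw (fun v => v \in V)) //.
- split=> [[[x [Cx ->]] hx]|[x [/(conv_coneP _ hV)[Cx hx] ->]]].
    by exists x; split=> //; apply/(conv_coneP _ hV); rewrite -hx htrop.
  by rewrite htrop; split=> //; exists x.
- by move=> a b na pb; have [c [d [_ [_ [[? ? _ _] [? _]]]]]] := ex na pb; exists c, d.
(* A generator at height -1 has moved by [w], so exchange in [V'] is the second equation of [ex]. *)
move=> a b [/V'E[a0 [Va0 ->]] fa] [/V'E[b0 [Vb0 ->]] fb].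
rewrite dotv_trop // in fa; rewrite dotv_trop // in fb.
have [||_ [_ [c [d [[_ _ zc zd] [_ E]]]]]] := @ex a0 b0; [by []|by []|].
exists c, d; split; [exact: zerV'|exact: zerV'|].
rewrite -E trop_le0 ?fa ?lerN10 // trop_ge0 ?fb //.
by rewrite scaleN1r opprK addrAC.
Qed.

Let int_dirmx b : b \in V -> intmx (dirmx V b).
Proof.
move=> Vb; apply/mxOverP => i j; rewrite !mxE rpredB //.
  by apply/(mxOverP (iV _))/mem_nth.
by apply/(mxOverP (iV Vb)).
Qed.

(** Serves when all vertices lie on one closed side of the wall: [w] may then fail to be parallel to
    the affine hull, but [trop] agrees on the vertices with an automorphism of the ambient
    lattice. *)
Let mut_step_linear (U U' : 'M[R]_D) :
    intmx U -> intmx U' -> U *m U' = 1%:M ->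
    (forall v, v \in V -> trop f w v = v *m U) ->
  mut_step (existT (pset R) D (conv V)) (existT (pset R) D (conv V')).
Proof.
move=> iU iU' UU' tU; have [b Vb] : exists b, b \in V.
  by case: (V) V0 => // b s _; exists b; rewrite mem_head.
have [d [M [iM fM VM sat]]] := lattice_basis (int_dirmx Vb).
apply: (mut_step_unimodular (identifies_conv Vb (iV Vb) iM fM VM sat) iU iU' UU').
move=> y; have -> : y = 0 + (y *m U') *m U.
  by rewrite add0r -mulmxA (mulmx1C UU') mulmx1.
rewrite add0r -(mulmxA _ U U') UU' mulmx1 -[X in conv V' X]add0r.
rewrite -(@conv_affine _ _ _ [seq 0 + z *m U | z <- V] 0 U V) //; last first.
  by apply/row_freeP; exists U'.
apply: conv_eq_mem (h) _ _ _ _ _ => v.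
  by case/mapP => u Vu ->; rewrite add0r -tU //; apply/hV'/V'E; exists u.
split=> [/V'E[u [Vu ->]]|/mapP[u Vu ->]].
  by rewrite tU //; apply/mapP; exists u; rewrite ?add0r.
by apply/V'E; exists u; rewrite add0r tU.
Qed.

(** A wall vertex [b] as origin makes [f] a linear form in the chart, and [w] being parallel to both
    affine hulls lets one chart [M] serve for [V] and [V']. *)
Let mut_step_wall b : b \in V -> dotv f b = 0 -> (w <= dirmx V b)%MS ->
    (w <= dirmx V' b)%MS ->
  mut_step (existT (pset R) D (conv V)) (existT (pset R) D (conv V')).
Proof.
move=> Vb fb wV wV'; have iw : intmx w by apply/int_vecP; case: pw.
have V'b : b \in V' by apply/V'E; exists b; rewrite trop_ge0 ?fb.
have ib := iV Vb.
have [d [M [iM fM VM sat]]] := lattice_basis (int_dirmx Vb).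
have VV' : (dirmx V' b :=: M)%MS.
  apply: eqmx_trans VM; apply/eqmxP/andP; split; apply/row_subP => i; rewrite row_dirmx.
    have /V'E[u [Vu ->]] : V'`_i \in V' by rewrite mem_nth.
    by rewrite /trop addrAC addmx_sub ?sub_dirmx // -scaleNr scalemx_sub.
  have Vi : V`_i \in V by rewrite mem_nth.
  rewrite -[V`_i](subrK (Num.min 0 (dotv f V`_i) *: w)) -/(trop f w _) addrAC.
  rewrite addmx_sub ?scalemx_sub // sub_dirmx //; apply/V'E.
  by exists V`_i.
have inM x : conv V x -> (x - b <= M)%MS.
  move=> Px; rewrite -VM; apply/(aff_hull_conv _ Vb).
  by exists 1%N, (fun=> x), (fun=> 1); rewrite !big_ord1 scale1r.
have wM : w *m pinvmx M *m M = w by rewrite mulmxKpV // -VM.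
exists d, (fun x => conv V (b + x *m M)), (fun x => conv V' (b + x *m M)).
split; [by apply: identifies_conv| |right].
  by apply: identifies_conv.
pose W := [seq (v - b) *m pinvmx M | v <- V].
have VW : V = [seq b + z *m M | z <- W].
  rewrite -map_comp -[LHS]map_id; apply/eq_in_map => v Vv /=.
  by rewrite mulmxKpV ?inM ?(addrC b) ?subrK //; apply: conv_mem.
split; [|split; first by rewrite mul0mx addr0; apply: conv_mem].
  exists W; split; [by rewrite -size_eq0 size_map size_eq0|split].
    move=> _ /mapP[v Vv ->]; apply/int_vecP/sat; first by apply: intmxB; auto.
    by apply/inM/conv_mem.
  by move=> x; apply: conv_affine.
(* [w'] is [w] in chart coordinates and [f'] the pullback of [f]; the chart intertwines the two
   tropical maps. *)
pose w' := w *m pinvmx M; pose f' := f *m M^T.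
have fE x : dotv f (b + x *m M) = dotv f' x.
  by rewrite dotvD fb add0r !dotv_mx trmx_mul trmxK mulmxA.
have f'w' : dotv f' w' = 0 by rewrite -fE dotvD fb add0r wM.
have tropE x : trop f w (b + x *m M) = b + (trop f' w' x) *m M.
  by rewrite /trop fE mulmxBl -scalemxAl wM addrA.
have iMT : intmx M^T by apply/mxOverP => i j; rewrite mxE; apply: (mxOverP iM).
exists w', [:: 0; f']; split=> //.
- split; first by apply/int_vecP/sat; rewrite // -VM.
  (* An integral divisor of [w'] is carried by [M] to one of [w]. *)
  case: pw => _ prim k v /int_vecP iv w'E.
  apply: (prim k (v *m M)); first by apply/int_vecP/intmxM.
  by rewrite scalemxAl -w'E.
- move=> g; rewrite !inE => /orP[]/eqP->; split=> //.
  + by apply/int_vecP; apply/mxOverP => i j; rewrite mxE.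
  + by rewrite /dotv big1 // => i _; rewrite mxE mul0r.
  + exact/int_vecP/intmxM.
- have dot_seg t u : dotv (t *: f') u = t * dotv f' u.
    by rewrite /dotv mulr_sumr; apply: eq_bigr => i _; rewrite mxE mulrA.
  have tge (t a : R) : t <= 1 -> a <= 0 -> a <= t * a.
    by move=> t1 a0; have := ler_wnM2r a0 t1; rewrite mul1r.
  have minP u m : [/\ exists g, conv [:: 0; f'] g /\ dotv g u = m,
      forall g, conv [:: 0; f'] g -> m <= dotv g u & True] <->
      m = Num.min 0 (dotv f' u).
    have c0 : conv [:: 0; f'] 0 by apply: conv_mem; rewrite inE eqxx.
    have c1 : conv [:: 0; f'] f' by apply: conv_mem; rewrite !inE eqxx orbT.
    have d0 : dotv 0 u = 0 by rewrite -(scale0r f') dot_seg mul0r.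
    split=> [[[g [/conv_segmentP[t /andP[t0 t1] ->] <-]] le_m _]|->].
      have := le_m _ c0; have := le_m _ c1; rewrite d0 dot_seg.
      move=> l1 l2; case: (leP 0 (dotv f' u)) => h0; apply/eqP;
        rewrite eq_le ?l1 ?l2 ?mulr_ge0 //=.
      by apply: tge => //; apply: ltW.
    split=> //.
      by case: (leP 0 (dotv f' u)) => h0; [exists 0; rewrite d0 | exists f'].
    move=> g /conv_segmentP[t /andP[t0 t1] ->]; rewrite dot_seg.
    case: (leP 0 (dotv f' u)) => h0; first exact: mulr_ge0.
    by apply: tge => //; apply: ltW.
  move=> y; rewrite conv_trop; split=> [[x [Px yE]]|[u [Pu [m [mE le_m ->]]]]].
    exists ((x - b) *m pinvmx M).
    have xE : b + (x - b) *m pinvmx M *m M = x.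
      by rewrite mulmxKpV ?inM // (addrC b) subrK.
    rewrite xE; split=> //.
    set u := (x - b) *m _ in xE *; have [mE le_m _] := (minP u _).2 erefl.
    exists (Num.min 0 (dotv f' u)); split=> //.
    by move: yE; rewrite -xE tropE => /addrI/(row_free_inj fM).
  exists (b + u *m M); split=> //; rewrite tropE /trop.
  by rewrite -((minP u m).1 _).
(* Convexity is now free: [conv_trop] has exhibited the image as a convex hull. *)
move=> x y t Px Py t01.
have -> : b + (t *: x + (1 - t) *: y) *m M =
    t *: (b + x *m M) + (1 - t) *: (b + y *m M).
  rewrite mulmxDl -!scalemxAl !scalerDr addrACA -scalerDl.
  by rewrite [t + _]addrC subrK scale1r.
exact: conv_convex.
Qed.

Lemma mut_step_trop :
  mut_step (existT (pset R) D (conv V)) (existT (pset R) D (conv V')).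
Proof.
have iw : intmx w by apply/int_vecP; case: pw.
have i1 : intmx (1%:M : 'M[R]_D).
  by apply/mxOverP => i j; rewrite mxE; case: eqP.
have ifw : intmx (f^T *m w).
  by apply: intmxM => //; apply/mxOverP => i j; rewrite mxE; apply: (mxOverP i_f).
have [/hasP[a Va /eqP fa]|/hasPn noneg] := boolP (has (fun v => dotv f v == -1) V);
  last first.
  (* With no vertex at height -1, [trop] is the identity on [V]. *)
  apply: (mut_step_linear i1 i1) => [|v Vv]; rewrite mulmx1 // trop_ge0 //.
  by case: (small Vv) => // [|-> //|-> //]; move: (noneg _ Vv) => /eqP.
have [/hasP[b Vb /eqP f_b]|/hasPn nopos] := boolP (has (fun v => dotv f v == 1) V);
  last first.
  (* With no vertex at height 1, [trop] is a shear on [V]; the sign change inverts it because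
     [dotv f w = 0] makes [f^T *m w] square to zero. *)
  apply: (mut_step_linear (U := 1%:M - f^T *m w) (U' := 1%:M + f^T *m w)).
  - exact: intmxB.
  - exact: intmxD.
  - have ww : f^T *m w *m (f^T *m w) = 0.
      rewrite mulmxA -(mulmxA f^T w) (_ : w *m f^T = 0) ?mulmx0 ?mul0mx //.
      by apply/matrixP => i j; rewrite !ord1 -dotv_mx fw mxE.
    by rewrite mulmxDr mulmxBl !mulmx1 mulmxBl mul1mx ww subr0 subrK.
  move=> v Vv; rewrite trop_le0; last first.
    by case: (small Vv) => // [->|->|] //; rewrite ?lerN10 //; move: (nopos _ Vv) => /eqP.
  rewrite mulmxBr mulmx1 mulmxA; congr (_ - _).
  by rewrite [v *m _]mx11_scalar -dotv_mx mul_scalar_mx.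
have [c [d [c' [d' [[zc zd zc' zd'] [E E']]]]]] := ex (conj Va fa) (conj Vb f_b).
(* Subtracting the two equations of [ex] writes [w] in differences of wall vertices. These are fixed
   by [trop], so [w] is parallel to both affine hulls. *)
have wE : w = (c' - c) + (d' - c) - (d - c).
  apply: (addrI (a + b)); rewrite E' E; apply/rowP => i; rewrite !mxE; ring.
have w_sub (W : seq 'rV[R]_D) : c' \in W -> d' \in W -> d \in W ->
    (w <= dirmx W c)%MS.
  move=> Wc' Wd' Wd; rewrite wE; apply: addmx_sub; last first.
    by rewrite eqmx_opp sub_dirmx.
  by apply: addmx_sub; apply: sub_dirmx.
have [Vc fc] := zc; apply: (mut_step_wall Vc fc); apply: w_sub.
- by case: zc'.
- by case: zd'.
- by case: zd.
- by case: (zerV' zc').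
- by case: (zerV' zd').
- by case: (zerV' zd).
Qed.

End Mutation.

(** * Matching fields given by an order of the columns *)

Section MatchingFields.
Variables (R : realType) (n : nat).
Implicit Types (x y z m j : 'I_n) (k : 'I_n -> nat).

Let r0 : 'I_3 := ord0.
Let r1 : 'I_3 := inord 1.
Let r2 : 'I_3 := inord 2.

Let r1E : (r1 : nat) = 1%N. Proof. exact: inordK. Qed.
Let r2E : (r2 : nat) = 2%N. Proof. exact: inordK. Qed.
Let r10 : (r1 == r0) = false. Proof. by rewrite -val_eqE /= r1E. Qed.
Let r20 : (r2 == r0) = false. Proof. by rewrite -val_eqE /= r2E. Qed.
Let r21 : (r2 == r1) = false. Proof. by rewrite -val_eqE /= r1E r2E. Qed.

Definition evec (a : 'I_3) x : 'rV[R]_(3 * n) := mxvec (delta_mx a x).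

Lemma dotv_evec (F : 'M[R]_(3, n)) a x : dotv (mxvec F) (evec a x) = F a x.
Proof.
rewrite /evec mxvec_delta /dotv (bigD1 (mxvec_index a x)) //= big1 => [|i].
  by rewrite mxE !eqxx mulr1 addr0 mxvecE.
by move=> /negbTE ne; rewrite mxE ne andbF mulr0.
Qed.

Lemma intmx_mxvec (F : 'M[R]_(3, n)) : intmx F -> intmx (mxvec F).
Proof.
move=> iF; apply/mxOverP => i k; rewrite (ord1 i).
by case/mxvec_indexP: k => a x; rewrite mxvecE; apply: (mxOverP iF).
Qed.

Lemma intmx_evec a x : intmx (evec a x).
Proof.
apply: intmx_mxvec; apply/mxOverP => i j; rewrite mxE.
by apply/intrP; exists ((i == a) && (j == x))%:R; case: (_ && _).
Qed.

Definition vertex x y z := evec r0 x + evec r1 y + evec r2 z.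

Lemma intmx_vertex x y z : intmx (vertex x y z).
Proof.
exact: intmxD (intmxD (intmx_evec _ _) (intmx_evec _ _)) (intmx_evec _ _).
Qed.

Lemma dotv_vertex F x y z :
  dotv (mxvec F) (vertex x y z) = F r0 x + F r1 y + F r2 z.
Proof. by rewrite !dotvD !dotv_evec. Qed.

(** Supplies the form [h]: a vertex has a single entry in row 3, and the direction of a swap has
    none. *)
Definition mass : 'rV[R]_(3 * n) := mxvec (\matrix_(a, x) (a == r2)%:R).

(* The matching field in which, of the two smallest elements of a 3-subset,
   the one with the larger key is sent to row 2. *)
Definition key_vertices k : seq 'rV[R]_(3 * n) :=
  [seq vertex t.1.1 t.1.2 t.2 | t <- enum [pred t : 'I_n * 'I_n * 'I_n |
     [&& k t.1.1 < k t.1.2, t.1.1 < t.2 & t.1.2 < t.2]%N]].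

Lemma key_verticesP k v : reflect
  (exists x y z, [/\ (k x < k y)%N, (x < z)%N, (y < z)%N & v = vertex x y z])
  (v \in key_vertices k).
Proof.
apply: (iffP mapP) => [[[[x y] z]]|[x [y [z [kxy xz yz ->]]]]].
  by rewrite mem_enum => /and3P[? ? ?] ->; exists x, y, z.
by exists (x, y, z); rewrite // mem_enum; apply/and3P.
Qed.

Lemma eq_key_vertices k k' : (forall x y, (k x < k y)%N = (k' x < k' y)%N) ->
  key_vertices k = key_vertices k'.
Proof.
move=> kk'; rewrite /key_vertices; congr map; apply: eq_enum => t.
by rewrite !inE kk'.
Qed.

Lemma mass_key_vertices k v : v \in key_vertices k -> dotv mass v = 1.
Proof.
case/key_verticesP=> x [y [z [_ _ _ ->]]]; rewrite dotv_vertex !mxE.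
by rewrite ![_ == r2]eq_sym r20 r21 eqxx !add0r.
Qed.

Definition key_poly k : Defs.poly R := existT (pset R) (3 * n)%N (conv (key_vertices k)).

(* The last hypothesis is the exchange property: the third columns [p], [q] of
   a pair of vertices on opposite sides of the wall can be redistributed over
   the pairs {m,u}, {d,j} and over the pairs {j,u}, {d,m}. *)
Lemma mut_step_adjacent k k' m j :
    key_vertices k != [::] ->
    (k m < k j)%N -> (k' j < k' m)%N ->
    (forall x y, ~ (x = m /\ y = j) -> ~ (x = j /\ y = m) ->
       (k x < k y)%N = (k' x < k' y)%N) ->
    (forall x, [\/ x = m, x = j, (k x < k m)%N | (k j < k x)%N]) ->
    (forall d u p q : 'I_n, (k d < k m)%N -> (k j < k u)%N ->
       (m < p)%N -> (j < p)%N -> (d < q)%N -> (u < q)%N ->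
       exists p1 q1 p2 q2 : 'I_n,
       [/\ evec r2 p + evec r2 q = evec r2 p1 + evec r2 q1,
           evec r2 p + evec r2 q = evec r2 p2 + evec r2 q2,
           [&& m < p1, u < p1, d < q1 & j < q1]%N &
           [&& j < p2, u < p2, d < q2 & m < q2]%N]) ->
  mut_step (key_poly k) (key_poly k').
Proof.
move=> V0 kmj k'jm kk' adj ex.
pose F : 'M[R]_(3, n) := \matrix_(a, x)
  if a == r0 then (if (k x < k m)%N then 0 else -1)
  else if a == r1 then (k j < k x)%N%:R else 0.
have FE x y z : dotv (mxvec F) (vertex x y z) =
    (if (k x < k m)%N then 0 else -1) + (k j < k y)%N%:R.
  by rewrite dotv_vertex !mxE eqxx r10 eqxx r20 r21 addr0.
pose w := evec r1 m - evec r0 m + evec r0 j - evec r1 j.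
have nmj : m != j by apply: contraTneq kmj => ->; rewrite ltnn.
have wE G : dotv (mxvec G) w = G r1 m - G r0 m + G r0 j - G r1 j.
  by rewrite !dotvE !dotv_evec.
have kjm : (k j < k m)%N = false by apply/negbTE; rewrite -leqNgt ltnW.
have fw : dotv (mxvec F) w = 0.
  by rewrite wE !mxE r10 !eqxx !ltnn kjm /=; ring.
(* As [m] and [j] are neighbours for [k], no other increasing pair fits between them: height -1
   singles out this pair. *)
have mid x y : (k x < k y)%N -> (k x < k m)%N = false -> (k j < k y)%N = false ->
    x = m /\ y = j.
  move=> kxy kxm kjy.
  have := adj x; have := adj y; rewrite kxm kjy.
  case=> [yE|yE|kym|//] [xE|xE|//|kjx]; rewrite ?xE ?yE in kxy * => //.
  - by rewrite ltnn in kxy.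
  - by rewrite kjm in kxy.
  - by lia.
  - by rewrite ltnn in kxy.
  - by lia.
  - by lia.
  - by lia.
  - by lia.
have swap z : trop (mxvec F) w (vertex m j z) = vertex j m z.
  rewrite trop_le0 FE ltnn ltnn addr0 ?lerN10 // scaleN1r opprK.
  by rewrite /vertex /w; apply/rowP => i; rewrite !mxE; ring.
have stay x y z : (k x < k y)%N -> ~ (x = m /\ y = j) ->
    trop (mxvec F) w (vertex x y z) = vertex x y z.
  move=> kxy ne; rewrite trop_ge0 // FE.
  case kxm: (k x < k m)%N; case kjy: (k j < k y)%N; rewrite ?addr0 ?add0r ?addNr //.
  by case: ne; apply: mid.
apply: (@mut_step_trop _ _ _ _ (mxvec F) w mass) => //.
- by move=> v /key_verticesP[x [y [z [_ _ _ ->]]]]; apply: intmx_vertex.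
- exact: mass_key_vertices.
- by rewrite wE !mxE ![_ == r2]eq_sym r20 r21 !subr0 addr0.
- apply: intmx_mxvec; apply/mxOverP => a x; rewrite mxE.
  by do !case: ifP => // _; rewrite ?rpredN ?rpred1 ?rpred0 ?rpred_nat.
- split.
    apply/int_vecP; exact: intmxB (intmxD (intmxB (intmx_evec _ _)
      (intmx_evec _ _)) (intmx_evec _ _)) (intmx_evec _ _).
  (* The entry of [w] in row 2 and column [m] is 1, so [c] divides 1. *)
  move=> c v /(_ (mxvec_index r1 m))[q vq] /rowP/(_ (mxvec_index r1 m)).
  rewrite /w /evec !mxE !mxvecE !mxE !eqxx r10 (negbTE nmj) /= vq -intrM.
  rewrite !subr0 !addr0 => /esym cq1.
  have /eqP : (c * q)%:~R = 1%:~R :> R by rewrite cq1.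
  rewrite eqr_int => /eqP cq.
  have : (`|c| * `|q| = 1)%N by rewrite -abszM cq.
  by move/eqP; rewrite muln_eq1 => /andP[/eqP c1 _]; rewrite -abszE c1.
- move=> v /key_verticesP[x [y [z [_ _ _ ->]]]]; rewrite FE.
  case: ifP => _; case: (k j < k y)%N; rewrite ?addr0 ?add0r ?addNr.
  + by apply: Or33.
  + by apply: Or32.
  + by apply: Or32.
  + by apply: Or31.
- move=> v; split=> [/key_verticesP[x [y [z [kxy xz yz ->]]]]|].
    have [[xj ym]|ne] := pselect (x = j /\ y = m).
      exists (vertex m j z); rewrite swap xj ym; split=> //.
      by apply/key_verticesP; exists m, j, z; rewrite -xj -ym; split=> //; rewrite ym xj.
    have ne' : ~ (x = m /\ y = j).
      by move=> [xm yj]; move: kxy; rewrite xm yj ltnNge ltnW.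
    rewrite -kk' // in kxy.
    by exists (vertex x y z); rewrite stay //; split=> //;
      apply/key_verticesP; exists x, y, z.
  case=> _ [/key_verticesP[x [y [z [kxy xz yz ->]]]] ->].
  have [[xm yj]|ne] := pselect (x = m /\ y = j).
    by rewrite xm yj swap; apply/key_verticesP; exists j, m, z;
      rewrite -xm -yj; split=> //; rewrite xm yj.
  rewrite stay //; apply/key_verticesP; exists x, y, z; rewrite -kk' //.
  by move=> [xj ym]; rewrite xj ym kjm in kxy.
move=> _ _ [/key_verticesP[x [y [p [kxy xp yp ->]]]] fa]
  [/key_verticesP[d [u [q [kdu dq uq ->]]]] fb].
have [xm yj] : x = m /\ y = j.
  apply: mid => //; move: fa; rewrite FE; case: (k x < k m)%N;
    case: (k j < k y)%N => //= h; exfalso; lra.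
have [kdm kju] : (k d < k m)%N /\ (k j < k u)%N.
  move: fb; rewrite FE; case: (k d < k m)%N;
    case: (k j < k u)%N => //= h; exfalso; lra.
subst x y.
have [p1 [q1 [p2 [q2 [e1 e2 /and4P[h1 h2 h3 h4] /and4P[g1 g2 g3 g4]]]]]] :=
  ex _ _ _ _ kdm kju xp yp dq uq.
have kdj := ltn_trans kdm kmj; have kmu := ltn_trans kmj kju.
(* The first two vertices regroup the entries of the given pair; the last two do so after [m] and
   [j] have traded rows, which accounts for [w]. *)
exists (vertex m u p1), (vertex d j q1), (vertex j u p2), (vertex d m q2).
split; last split.
- split; split; rewrite ?FE ?ltnn ?kdm ?kju ?kjm ?addNr ?addr0 //;
    apply/key_verticesP.
  + by exists m, u, p1.
  + by exists d, j, q1.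
  + by exists j, u, p2.
  + by exists d, m, q2.
- rewrite /vertex; move: e1; set P := evec r2 p; set Q := evec r2 q => e1.
  transitivity (evec r0 m + evec r1 j + (evec r0 d + evec r1 u) + (P + Q)).
    by apply/rowP => i; rewrite !mxE; ring.
  by rewrite e1; apply/rowP => i; rewrite !mxE; ring.
rewrite /vertex /w; move: e2; set P := evec r2 p; set Q := evec r2 q => e2.
transitivity (evec r1 m + evec r0 j + (evec r0 d + evec r1 u) + (P + Q)).
  by apply/rowP => i; rewrite !mxE; ring.
by rewrite e2; apply/rowP => i; rewrite !mxE; ring.
Qed.

End MatchingFields.

(** * Block diagonal fields as orders of the columns *)

Section BlockDiagonal.
Variables (R : realType) (n : nat).
Implicit Types (a b c x y z : 'I_n).

Lemma card3_sorted (J : {set 'I_n}) : #|J| = 3%N ->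
  exists a b c, [/\ (a < b)%N, (b < c)%N & J = [set a; b; c]].
Proof.
move=> J3; have srt : sorted (relpre val ltn) (enum J).
  rewrite /enum_mem; apply: sorted_filter => [? ? ?|]; first exact: ltn_trans.
  by rewrite -sorted_map -enumT val_enum_ord iota_ltn_sorted.
have JE := set_enum J; rewrite cardE in J3.
case: (enum J) J3 srt JE => [|a [|b [|c [|? ?]]]] //= _ /and3P[ab bc _] <-.
by exists a, b, c; split=> //; apply/setP => x; rewrite !inE orbA.
Qed.

Lemma card_filter3 a b c (P : pred 'I_n) : (a < b)%N -> (b < c)%N ->
  #|[set k in [set a; b; c] | P k]| = (P a + P b + P c)%N.
Proof.
move=> ab bc; rewrite -sum1_card big_mkcond /=.
under eq_bigr do rewrite !inE.
rewrite (bigD1 a) //= (bigD1 b) /=; last by rewrite -val_eqE /= gtn_eqF.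
rewrite (bigD1 c) /=; last by rewrite -!val_eqE /= !gtn_eqF // (ltn_trans ab).
rewrite !eqxx ?orbT /= big1 => [|i /andP[/andP[/negbTE-> /negbTE->] /negbTE->]] //.
by rewrite addn0 addnA; case: (P a); case: (P b); case: (P c).
Qed.

Lemma mf_vertex3 a b c (s : 'S_3) : (a < b)%N -> (b < c)%N ->
  mxvec (mf_vertex R s [set a; b; c]) =
  evec R (s ord0) a + evec R (s (inord 1)) b + evec R (s (inord 2)) c.
Proof.
move=> ab bc; rewrite /evec -!raddfD /=; congr mxvec; apply/matrixP => i j.
have ac := ltn_trans ab bc.
have rkE x : rk [set a; b; c] x = ((a < x) + (b < x) + (c < x))%N.
  by rewrite /rk card_filter3.
have nab : a != b by rewrite -val_eqE /= ltn_eqF.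
have nac : a != c by rewrite -val_eqE /= ltn_eqF.
have nbc : b != c by rewrite -val_eqE /= ltn_eqF.
rewrite !mxE rkE !inE -orbA ![i == _]eq_sym.
case: (eqVneq j a) => [->|nja] /=.
  rewrite ltnn [(b < a)%N]ltnNge [(c < a)%N]ltnNge (ltnW ab) (ltnW ac) /=.
  rewrite (negbTE nab) (negbTE nac) !andbF andbT !addr0.
  by congr (s _ == _)%:R; apply: val_inj; rewrite /= inordK.
case: (eqVneq j b) => [->|njb] /=.
  rewrite ltnn ab [(c < b)%N]ltnNge (ltnW bc) (negbTE nbc) !andbF andbT.
  by rewrite add0r addr0.
case: (eqVneq j c) => [->|njc] /=; last by rewrite !andbF !addr0.
by rewrite ac bc ltnn !andbF andbT !add0r.
Qed.

(** Adding [n] lifts the first [l] columns above all others and keeps the natural order inside each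
    block. *)
Definition block_key (l : nat) (x : 'I_n) : nat := if (x < l)%N then (n + x)%N else x.

Lemma block_diag3 l a b c : (a < b)%N -> (b < c)%N ->
  block_diag l [set a; b; c] =
  if (block_key l a < block_key l b)%N then 1%g else tperm (ord0 : 'I_3) (inord 1).
Proof.
move=> ab bc; rewrite /block_diag card_filter3 //=.
(* As [a < b < c], exactly one of them is below [l] when [a] is and [b] is not, the only case in
   which the keys reverse [a < b]. *)
have -> : (block_key l a < block_key l b)%N = ((a < l) + (b < l) + (c < l) != 1)%N.
  rewrite /block_key; have := ltn_ord b.
  by case: (ltnP a l) => al; case: (ltnP b l) => bl; case: (ltnP c l) => cl /=; lia.
by rewrite if_neg.
Qed.

Lemma mf_vertex_block l a b c : (a < b)%N -> (b < c)%N ->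
  mxvec (mf_vertex R (block_diag l [set a; b; c]) [set a; b; c]) =
  if (block_key l a < block_key l b)%N then vertex R a b c else vertex R b a c.
Proof.
move=> ab bc; rewrite mf_vertex3 // block_diag3 // /vertex; case: ifP => _.
  by rewrite !perm1.
rewrite tpermL tpermR tpermD ?[evec _ _ a + _]addrC //.
  by rewrite -val_eqE /= inordK.
by rewrite -val_eqE /= !inordK.
Qed.

Lemma mf_polytope_block l :
  existT (pset R) (3 * n)%N (mf_polytope (R := R) (@block_diag n l)) =
  key_poly R (block_key l).
Proof.
congr existT; apply: funext => x; apply: propext.
apply: (conv_eq_mem (h := mass R n)); first exact: mass_key_vertices.
have keyI y z : block_key l y = block_key l z -> y = z.
  move=> h; apply: val_inj => /=; move: h (ltn_ord y) (ltn_ord z).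
  rewrite /block_key; case: ltnP => ?; case: ltnP => ?; lia.
have card3 a b c : (a < b)%N -> (b < c)%N -> #|[set a; b; c]| == 3%N.
  move=> ab bc; apply/eqP; rewrite -[RHS](card_filter3 predT ab bc).
  by apply: eq_card => i; rewrite !inE andbT.
move=> v; split.
  case/mapP => J; rewrite mem_enum inE => /eqP/card3_sorted[a [b [c [ab bc ->]]]] ->.
  rewrite mf_vertex_block //; have ac := ltn_trans ab bc.
  case: ltnP => kab; apply/key_verticesP; first by exists a, b, c.
  exists b, a, c; split=> //; rewrite ltn_neqAle kab andbT.
  by apply/eqP => /keyI ba; rewrite ba ltnn in ab.
case/key_verticesP=> y [z [c [kyz yc zc ->]]].
have [yz|zy|yz] := ltngtP y z; last by move/val_inj: yz kyz => ->; rewrite ltnn.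
  have zc3 := card3 _ _ _ yz zc.
  apply/mapP; exists [set y; z; c]; first by rewrite mem_enum inE.
  by rewrite mf_vertex_block // kyz.
have zc3 := card3 _ _ _ zy yc.
apply/mapP; exists [set z; y; c]; first by rewrite mem_enum inE.
by rewrite mf_vertex_block // ltnNge (ltnW kyz).
Qed.

(** * Carrying one column from the bottom to the top of the order *)

Section Rotation.
Variable m : 'I_n.

(* Doubled keys: [m] climbs through the odd values from the bottom of the order
   of [block_key m] to the top of that of [block_key m.+1]. *)
Definition climb_key (s : nat) (x : 'I_n) : nat :=
  if (x : nat) == m then (2 * (m + s)).+1 else (2 * block_key m x)%N.

Lemma climb_keyP s x :
  [\/ x = m /\ climb_key s x = (2 * (m + s)).+1,
      (x < m)%N /\ climb_key s x = (2 * (n + x))%N |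
      (m < x)%N /\ climb_key s x = (2 * x)%N].
Proof.
rewrite /climb_key /block_key; case: ltngtP => [xm|xm|/val_inj->].
- by apply: Or32.
- by apply: Or33.
- by apply: Or31.
Qed.

Lemma key_vertices_neq0 k : (2 < n)%N -> (forall x y : 'I_n, k x = k y -> x = y) ->
  key_vertices R k != [::].
Proof.
move=> n3 kI; pose o i (h : (i < n)%N) : 'I_n := Ordinal h.
have h1 : (1 < n)%N by exact: ltnW.
have h0 : (0 < n)%N by exact: ltnW.
suff [v Vv] : exists v, v \in key_vertices R k by apply: contraTneq Vv => ->.
have [lt|lt|/kI] := ltngtP (k (o 0 h0)) (k (o 1 h1)).
- eexists; apply/key_verticesP; exists (o 0 h0), (o 1 h1), (o 2 n3); split=> //.
- eexists; apply/key_verticesP; exists (o 1 h1), (o 0 h0), (o 2 n3); split=> //.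
by move/(congr1 val).
Qed.

Lemma climb_key_inj s x y : climb_key s x = climb_key s y -> x = y.
Proof.
move=> h; apply: val_inj => /=; move: h (ltn_ord x) (ltn_ord y).
by have [[-> ->]|[? ->]|[? ->]] := climb_keyP s x;
  have [[-> ->]|[? ->]|[? ->]] := climb_keyP s y; lia.
Qed.

Lemma mut_step_climb s : (2 < n)%N -> (s.+1 < n)%N ->
  mut_step (key_poly R (climb_key s)) (key_poly R (climb_key s.+1)).
Proof.
move=> n3 sn; have mn := ltn_ord m.
(* The only even number between the old and new keys of [m] is the key of column [m + s + 1],
   reduced modulo [n]. *)
have [j [jm jE]] : exists j : 'I_n, j != m /\ climb_key s j = (2 * (m + s).+1)%N.
  have [lt|ge] := ltnP (m + s).+1 n.
    exists (Ordinal lt); split; first by rewrite -val_eqE /=; lia.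
    have [[/(congr1 val)/= ? ->]|[/= ? ->]|[/= ? ->]] // := climb_keyP s (Ordinal lt); lia.
  have lt : ((m + s).+1 - n < n)%N by lia.
  exists (Ordinal lt); split; first by rewrite -val_eqE /=; lia.
  have [[/(congr1 val)/= ? ->]|[/= ? ->]|[/= ? ->]] // := climb_keyP s (Ordinal lt); lia.
have jE' : climb_key s.+1 j = climb_key s j.
  by rewrite /climb_key val_eqE (negbTE jm).
have mE t : climb_key t m = (2 * (m + t)).+1 by rewrite /climb_key eqxx.
apply: (@mut_step_adjacent _ _ _ _ m j).
- by apply: key_vertices_neq0 => // x y; apply: climb_key_inj.
- by rewrite mE jE; lia.
- by rewrite mE jE' jE; lia.
- move=> x y.
  have [->|xm] := eqVneq x m; have [->|ym] := eqVneq y m; rewrite ?ltnn //.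
  + move=> nj _; have nyj : y <> j by move=> h; apply: nj.
    have ky : climb_key s y <> climb_key s j by move/climb_key_inj.
    have -> : climb_key s.+1 y = climb_key s y by rewrite /climb_key val_eqE (negbTE ym).
    move: ky; rewrite !mE jE.
    have [[/eqP]|[? ->]|[? ->]] := climb_keyP s y; rewrite ?(negbTE ym) //; lia.
  + move=> _ nj; have nxj : x <> j by move=> h; apply: nj.
    have kx : climb_key s x <> climb_key s j by move/climb_key_inj.
    have -> : climb_key s.+1 x = climb_key s x by rewrite /climb_key val_eqE (negbTE xm).
    move: kx; rewrite !mE jE.
    have [[/eqP]|[? ->]|[? ->]] := climb_keyP s x; rewrite ?(negbTE xm) //; lia.
  by rewrite /climb_key !val_eqE (negbTE xm) (negbTE ym).
- move=> x; have [->|xm] := eqVneq x m; first by apply: Or41.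
  have [->|xj] := eqVneq x j; first by apply: Or42.
  have kx : climb_key s x <> climb_key s j by move/climb_key_inj/eqP; rewrite (negbTE xj).
  rewrite mE jE in kx *.
  have [lt|ge] := ltnP (climb_key s x) (2 * (m + s)).+1; first by apply: Or43.
  apply: Or44; move: kx ge.
  have [[/eqP]|[? ->]|[? ->]] := climb_keyP s x; rewrite ?(negbTE xm) //; lia.
move=> d u p q; rewrite mE jE => kd ku mp jp dq uq.
(* The columns [m], [d], [j], [u] occur in this cyclic order, so the pairs {m,j} and {d,u} cross.
   The two ways to uncross them are the required regroupings, and uncrossing never raises the two
   sorted maxima; hence [p] and [q] still fit, possibly interchanged. *)
have [] : ([&& m < p, u < p, d < q & j < q] \/ [&& m < q, u < q, d < p & j < p])%N /\
    ([&& j < p, u < p, d < q & m < q] \/ [&& j < q, u < q, d < p & m < p])%N.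
  move: kd ku jE; have := ltn_ord d; have := ltn_ord u; have := ltn_ord j;
    have := ltn_ord p; have := ltn_ord q.
  have [[-> ->]|[? ->]|[? ->]] := climb_keyP s d;
  have [[-> ->]|[? ->]|[? ->]] := climb_keyP s u;
  have [[/eqP]|[? ->]|[? ->]] := climb_keyP s j; rewrite ?(negbTE jm) //; try lia.
case=> h1 [] h2.
- by exists p, q, p, q.
- by exists p, q, q, p; split=> //; rewrite addrC.
- by exists q, p, p, q; split=> //; rewrite addrC.
- by exists q, p, q, p; split=> //; rewrite addrC.
Qed.

Lemma mut_seq_rcons (p q r : Defs.poly R) :
  mut_seq p q -> mut_step q r -> mut_seq p r.
Proof.
elim=> [p0|p0 q0 r0 st _ IH] h; last exact: mut_seq_cons st (IH h).
exact: mut_seq_cons h (mut_seq_refl _).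
Qed.

Lemma mut_seq_climb s : (2 < n)%N -> (s < n)%N ->
  mut_seq (key_poly R (climb_key 0)) (key_poly R (climb_key s)).
Proof.
move=> n3; elim: s => [|s IH] sn; first exact: mut_seq_refl.
by apply: (mut_seq_rcons (IH (ltnW sn))); apply: mut_step_climb.
Qed.

Lemma climb_key_start : key_poly R (climb_key 0) = key_poly R (block_key m).
Proof.
rewrite /key_poly (@eq_key_vertices _ _ _ (block_key m)) // => x y.
rewrite /climb_key /block_key; have := ltn_ord x; have := ltn_ord y.
by case: (ltngtP x m) => ?; case: (ltngtP y m) => ?; lia.
Qed.

(** After [n.-1] swaps [m] has passed every other column once. *)
Lemma climb_key_end : key_poly R (climb_key n.-1) = key_poly R (block_key m.+1).
Proof.
rewrite /key_poly (@eq_key_vertices _ _ _ (block_key m.+1)) // => x y.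
rewrite /climb_key /block_key !ltnS.
have := ltn_ord x; have := ltn_ord y; have := ltn_ord m.
by case: (ltngtP x m) => ?; case: (ltngtP y m) => ?; lia.
Qed.

End Rotation.
End BlockDiagonal.

Theorem theorem3p6 (R : realType) (n l : nat) :
  (4 <= n)%N -> (3 <= l)%N -> (l <= n - 1)%N ->
  mut_seq (existT (pset R) (3 * n)%N (@mf_polytope R n (@block_diag n l.-1)))
          (existT (pset R) (3 * n)%N (@mf_polytope R n (@block_diag n l))).
Proof.
move=> n4 l3 ln; rewrite !mf_polytope_block.
(* The moving column is number [l], whose zero-based index is [l.-1]. *)
have lt_m : (l.-1 < n)%N by lia.
have := @mut_seq_climb R n (Ordinal lt_m) n.-1.
rewrite climb_key_start climb_key_end /= (@prednK l); last by lia.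
by apply; lia.
Qed.
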